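(* Let $F$ be a field containing a primitive third root of unity $\rho$, let $A$ be a central simple $F$-algebra, and let $B=\{x_1,\dots,x_n\}\subseteq A$ be a coherent $3$-central set with associated directed graph $(B,E_B)$. Then there are no cycles of length greater than $3$ in $(B,E_B)$.
   Context: A finite set $B=\{x_1,\dots,x_n\}$ of invertible elements of $A$ is a $3$-central set if $x_k^3\in F$ for every $k$ and for all $i,j$ there is $c_{i,j}\in\mathbb{Z}/3\mathbb{Z}$ with $x_ix_j=\rho^{c_{i,j}}x_jx_i$. An $F$-subspace $V\subseteq A$ is $3$-central if $v^3\in F$ for every $v\in V$. A $3$-central set is coherent if its elements are linearly independent over $F$ and span a $3$-central space (i.e. it is a basis of a $3$-central space); in such a set no two distinct elements commute. The directed graph $(B,E_B)$ has vertex set $B$ and $(x_i,x_j)\in E_B$ if and only if $x_ix_j=\rho x_jx_i$ (i.e. $c_{i,j}=1$). A cycle of length $r$ is a sequence of vertices $a_1,\dots,a_r$ without repetitions such that $(a_1,a_2),\dots,(a_{r-1},a_r),(a_r,a_1)$ are all edges. *)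

(* Defs.v *)
From HB Require Import structures.
From mathcomp Require Export all_boot all_order all_algebra all_field.

Set Implicit Arguments.
Unset Strict Implicit.
Unset Printing Implicit Defensive.

Import GRing.Theory.

Local Open Scope ring_scope.

Section ThreeCentral.

Variables (F : fieldType) (A : falgType F).

(* A ring ideal of a finite-dimensional unital F-algebra is automatically an
   F-subspace, so ideals are represented as subspaces. *)
Definition two_sided_ideal (I : {vspace A}) : Prop :=
  (fullv * I <= I)%VS /\ (I * fullv <= I)%VS.

(* An falgType is a nonzero finite-dimensional unital associative algebra;
   1%VS is the line F.1, i.e. the copy of F inside A. *)
Definition central_simple : Prop :=
  center_vspace (fullv : {vspace A}) = 1%VS /\
  forall I : {vspace A}, two_sided_ideal I -> I = 0%VS \/ I = fullv.

(* A finite subset of A is given by a duplicate-free enumeration B. *)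
Definition three_central_set (rho : F) (B : seq A) : Prop :=
  [/\ uniq B,
      {in B, forall x, x \is a GRing.unit},
      {in B, forall x, x ^+ 3 \in 1%VS} &
      {in B &, forall x y, exists c : 'Z_3, x * y = rho ^+ c *: (y * x)}].

Definition three_central_space (V : {vspace A}) : Prop :=
  forall v, v \in V -> v ^+ 3 \in 1%VS.

Definition coherent_three_central_set (rho : F) (B : seq A) : Prop :=
  [/\ three_central_set rho B, free B & three_central_space <<B>>%VS].

Definition edge (rho : F) (B : seq A) : rel A :=
  [rel x y | [&& x \in B, y \in B & x * y == rho *: (y * x)]].

(* ucycle e c: consecutive entries of c, and (last, first), are e-related,
   and c has no repetitions. *)
Definition is_cycle (rho : F) (B : seq A) (c : seq A) : Prop :=
  {subset c <= B} /\ ucycle (edge rho B) c.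

End ThreeCentral.

(* Main.v *)
Require Import Defs.
From mathcomp Require Import all_boot all_order all_algebra all_field.
From mathcomp Require Import ring.

Import GRing.Theory.

Local Open Scope ring_scope.

(** An edge x -> y belongs to at most one directed triangle x -> y -> z -> x.
    Indeed, cubing general elements of the 3-central space spanned by B and
    polarizing shows that the sum of the six products of x, y, z in all orders
    is a scalar ([polar_cube_scalar], [polar_cubeDl]).  On a directed triangle
    each of the six products is a power of rho times xyz, and the coefficients
    add up to 3 (1 + rho^2) = - 3 rho, which is nonzero; so xyz is a scalar
    ([triangle_scalar]) and z is proportional to the inverse of xy.  As B is
    linearly independent, z is determined by x and y
    ([coherent_apex_unique]).

    Polarization also gives 3 x^2 y in F whenever x and y commute, which makes
    y proportional to x; hence distinct elements of B never commute and the
    graph is a tournament ([coherent_tournament]).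

    The rest is combinatorial ([no_long_cycle]).  In a tournament whose edges
    lie in at most one triangle, let x -> y -> z -> t -> ... -> x be a cycle of
    length at least 4.  If z -> x and t -> y, then y -> z lies in the triangles
    with apexes x and t.  Otherwise x -> z or y -> t is a chord; it gives a
    cycle that is shorter by one, still of length at least 4 unless the
    original length is 4, where either orientation of each diagonal produces
    two triangles with a common edge. *)

(** * Cycles in tournaments *)

(** Only the pairs of vertices on the cycle have to be joined by an edge, so
    that the hypothesis passes to the shorter cycle obtained from a chord. *)
Lemma no_long_cycle (T : eqType) (e : rel T) (c : seq T) :
    {in c &, forall x y, x != y -> e x y || e y x} ->
    (forall x y z t, e x y -> e y z -> e z x -> e y t -> e t x -> z = t) ->
  ucycle e c -> (size c <= 3)%N.
Proof.
move=> tour apex.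
have [n] := ubnP (size c).
elim: n c tour => // n IHn [|x [|y [|z [|t s]]]] // tour le_n /andP[cyc uq].
have neq (u v : T) : u != v -> u \in [:: x, y, z, t & s] ->
  v \in [:: x, y, z, t & s] -> e u v || e v u by move=> uv uc vc; apply: tour.
have shorten (u : T) : u \in [:: y; z] ->
    (0 < size s)%N -> cycle e [:: x, u, t & s] -> False.
  move=> u_yz s0 cyc'.
  (* Displaying both sequences as concatenations lets [cat_subseq] apply. *)
  have sub : subseq ([:: x; u] ++ t :: s) ([:: x; y; z] ++ t :: s).
    apply: cat_subseq (subseq_refl (t :: s)).
    by rewrite /= eqxx -/(subseq [:: u] [:: y; z]) sub1seq.
  have sub' := mem_subseq sub.
  have /IHn : {in [:: x, u, t & s] &, forall x y, x != y -> e x y || e y x}.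
    by move=> a b ac bc; apply: tour; apply: sub'.
  rewrite /ucycle cyc' (subseq_uniq sub uq) /=.
  by case: (s) s0 le_n => // ? ? _ /= le_n /(_ le_n isT).
move: (uq); rewrite /= !inE !negb_or.
case/and5P => /and4P[xy xz xt _] /and3P[yz yt _] /andP[zt _] _ _.
move: cyc; rewrite /= => /and4P[exy eyz ezt cyc].
have /orP := neq _ _ xz (mem_head _ _) ltac:(by rewrite !inE eqxx !orbT).
have /orP := neq _ _ yt ltac:(by rewrite !inE eqxx !orbT)
                        ltac:(by rewrite !inE eqxx !orbT).
case: (posnP (size s)) => [/size0nil s0 | s_gt0].
  (* Two diagonals, each with two orientations: in every case some edge of
     x -> y -> z -> t -> x lies in the triangles cut off by both diagonals. *)
  move: cyc; rewrite s0 /= andbT => etx [eyt|ety] [exz|ezx].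
  - by case/eqP: yz; exact: (apex t x y z).
  - by case/eqP: zt; rewrite (apex x y z t).
  - by case/eqP: xy; rewrite (apex z t x y).
  - by case/eqP: xt; rewrite (apex y z x t).
move=> [eyt _|ety [exz|ezx]].
- by case: (shorten y); rewrite ?inE ?eqxx //= exy eyt.
- by case: (shorten z); rewrite ?inE ?eqxx ?orbT //= exz ezt.
by case/eqP: xt; rewrite (apex y z x t).
Qed.

(** * Scalars and cube roots of unity *)

Lemma free_mem_scale (F : fieldType) (V : vectType F) (B : seq V) (x y : V)
    (k : F) :
  free B -> x \in B -> y \in B -> x = k *: y -> x = y.
Proof.
move=> frB xB yB xky; apply/eqP/contraT => neq_xy.
move: frB; rewrite (perm_free (perm_to_rem xB)) free_cons => /andP[/negP x_notin _].
case: x_notin; rewrite {1}xky memvZ ?memv_span //.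
by move: yB; rewrite (perm_mem (perm_to_rem xB)) inE eq_sym (negPf neq_xy).
Qed.

Lemma unit_scalar_neq0 (F : fieldType) (A : falgType F) (v : A) (a : F) :
  v \is a GRing.unit -> v = a%:A -> a != 0.
Proof.
by move=> v_unit def_v; apply: contraTneq v_unit => a0;
  rewrite def_v a0 scale0r unitr0.
Qed.

Section ThreeCentral.

Set Implicit Arguments.
Unset Strict Implicit.

Variables (F : fieldType) (rho : F) (A : falgType F).
Hypothesis rho_prim : 3.-primitive_root rho.

Lemma cube_root_expr3 : rho ^+ 3 = 1.
Proof. exact: prim_expr_order rho_prim. Qed.

Lemma cube_root_sub1_neq0 : rho - 1 != 0.
Proof.
rewrite subr_eq0; apply/eqP => r1.
by have := prim_order_dvd rho_prim 1; rewrite expr1 r1 eqxx.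
Qed.

Lemma cube_root_sum : 1 + rho + rho ^+ 2 = 0.
Proof.
apply: (mulfI cube_root_sub1_neq0); rewrite mulr0.
by rewrite (_ : _ * _ = rho ^+ 3 - 1); [rewrite cube_root_expr3 subrr | ring].
Qed.

Lemma cube_root_neq0 : rho != 0.
Proof.
apply/eqP => r0; have /eqP := cube_root_expr3.
by rewrite r0 expr0n eq_sym oner_eq0.
Qed.

Lemma three_neq0 : 3%:R != 0 :> F.
Proof. exact: prim_root_natf_neq0 rho_prim. Qed.

(** * Polarizing the cube *)

(** The part of (u + z)^3 that is quadratic in u and linear in z. *)
Definition polar_cube (u z : A) : A := u * u * z + u * z * u + z * u * u.

Lemma cube_addZ (u z : A) (a : F) :
  (u + a *: z) ^+ 3 =
    u ^+ 3 + a *: polar_cube u z + a ^+ 2 *: polar_cube z u + a ^+ 3 *: z ^+ 3.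
Proof.
rewrite /polar_cube !exprS !expr0 !mulr1 !mulrDr !mulrDl ?mulrDr.
rewrite -!(scalerAl, scalerAr) !scalerDr !scalerA !mulrA !addrA.
by rewrite [LHS](ACl (1*5*2*3*4*7*6*8)).
Qed.

Lemma polar_cubeDl (x y z : A) :
  polar_cube (x + y) z = polar_cube x z + polar_cube y z +
    (x * y * z + x * z * y + y * x * z + y * z * x + z * x * y + z * y * x).
Proof.
rewrite /polar_cube !mulrDl !mulrDr !mulrDl !addrA.
by rewrite [LHS](ACl (1*5*9*4*8*12*2*6*3*7*11*10)).
Qed.

Lemma q_commC (x y : A) :
  x * y = rho *: (y * x) -> y * x = rho ^+ 2 *: (x * y).
Proof. by move=> ->; rewrite scalerA -exprSr cube_root_expr3 scale1r. Qed.

Variable V : {vspace A}.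
Hypothesis V_central : three_central_space V.

(** The parts of (u + a z)^3 of degree 1 and 2 in a are separated by taking
    a = 1 and a = rho; the choice a = -1 would fail in characteristic 2. *)
Lemma polar_cube_scalar : {in V &, forall u z, polar_cube u z \in 1%VS}.
Proof.
move=> u z uV zV.
have cube a : a *: polar_cube u z + a ^+ 2 *: polar_cube z u \in 1%VS.
  have /V_central : u + a *: z \in V by rewrite rpredD ?rpredZ.
  rewrite cube_addZ -[X in X + _]addrA rpredDr ?rpredZ ?V_central //.
  by rewrite rpredDl ?V_central.
have rho_neq : rho - rho ^+ 2 != 0.
  rewrite -[X in X - _]mulr1 expr2 -mulrBr mulf_neq0 ?cube_root_neq0 //.
  by rewrite -opprB oppr_eq0 cube_root_sub1_neq0.
move: (polar_cube u z) (polar_cube z u) cube => P Q cube.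
suff: (rho - rho ^+ 2) *: P \in 1%VS by rewrite rpredZeq (negPf rho_neq).
have := rpredB (cube rho) (rpredZ (rho ^+ 2) (cube 1)).
rewrite expr1n !scale1r scalerDr opprD addrACA subrr addr0.
by rewrite -scalerBl.
Qed.

Lemma comm_scalar (x y : A) :
  x \in V -> y \in V -> GRing.comm x y -> x ^+ 2 * y \in 1%VS.
Proof.
move=> xV yV xy; have := polar_cube_scalar xV yV.
have yx : y * x = x * y by [].
rewrite /polar_cube yx -!(mulrA x y) yx mulrA -expr2.
by rewrite -mulr2n -mulrSr -scaler_nat rpredZeq (negPf three_neq0).
Qed.

(** For an acyclic triple the six coefficients add up to 0 instead, and there
    is no constraint on xyz: the orientation of the triangle matters. *)
Lemma triangle_scalar (x y z : A) :
    x \in V -> y \in V -> z \in V ->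
    x * y = rho *: (y * x) -> y * z = rho *: (z * y) ->
    z * x = rho *: (x * z) ->
  x * y * z \in 1%VS.
Proof.
move=> xV yV zV xy yz zx.
have yx := q_commC xy; have zy := q_commC yz.
have xzy : x * z * y = rho ^+ 2 *: (x * y * z).
  by rewrite -mulrA zy -scalerAr mulrA.
have yxz : y * x * z = rho ^+ 2 *: (x * y * z) by rewrite yx -scalerAl.
have yzx : y * z * x = x * y * z.
  by rewrite -mulrA zx -scalerAr mulrA yxz scalerA -exprS cube_root_expr3 scale1r.
have zxy : z * x * y = x * y * z.
  by rewrite zx -scalerAl xzy scalerA -exprS cube_root_expr3 scale1r.
have zyx : z * y * x = rho ^+ 2 *: (x * y * z).
  by rewrite zy -scalerAl yzx.
(* Linearizing in the first argument isolates the six mixed products. *)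
have := polar_cube_scalar (rpredD xV yV) zV.
rewrite polar_cubeDl rpredDl; last by rewrite rpredD ?polar_cube_scalar.
set t := x * y * z in xzy yxz yzx zxy zyx *.
have -> : t + x * z * y + y * x * z + y * z * x + z * x * y + z * y * x =
    (- (3%:R * rho)) *: t.
  rewrite xzy yxz yzx zxy zyx.
  transitivity ((1 + rho ^+ 2 + rho ^+ 2 + 1 + 1 + rho ^+ 2) *: t).
    by rewrite !scalerDl !scale1r.
  congr (_ *: _).
  have -> : rho ^+ 2 = - (1 + rho).
    by apply/eqP; rewrite -addr_eq0 addrC cube_root_sum.
  by ring.
by rewrite rpredZeq oppr_eq0 mulf_eq0 (negPf three_neq0) (negPf cube_root_neq0).
Qed.

End ThreeCentral.

(** * The graph of a coherent set *)

Section Coherent.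

Set Implicit Arguments.
Unset Strict Implicit.

Variables (F : fieldType) (rho : F) (A : falgType F) (B : seq A).
Hypotheses (rho_prim : 3.-primitive_root rho)
           (cohB : coherent_three_central_set rho B).

(** If x and y commute then x^2 y is a scalar, as is the unit x^3; comparing
    the two makes y a multiple of x, against linear independence. *)
Lemma coherent_tournament :
  {in B &, forall x y, x != y -> edge rho B x y || edge rho B y x}.
Proof.
case: cohB => -[_ unitB cubeB commB] freeB spanB x y xB yB xy.
rewrite /edge /= xB yB /=.
have [[c lt_c] /= xy_c] := commB x y xB yB.
rewrite xy_c; case: c lt_c xy_c => [|[|[|c]]] //= _.
- rewrite scale1r => xy_comm; case/eqP: xy; apply/esym.
  have /vlineP[a x2y] := comm_scalar rho_prim spanB (memv_span xB)
    (memv_span yB) xy_comm.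
  have /vlineP[b x3] := cubeB x xB.
  have b_neq0 : b != 0.
    by apply: unit_scalar_neq0 x3; rewrite unitrX ?unitB.
  apply: (@free_mem_scale _ _ B _ _ (b^-1 * a) freeB yB xB).
  rewrite -scalerA -[x in _ *: (_ *: x)]mulr1 scalerAr -x2y.
  by rewrite mulrA -exprS x3 -scalerAl mul1r scalerA mulVf ?scale1r.
- by rewrite expr1 eqxx.
by rewrite scalerA -exprS (cube_root_expr3 rho_prim) scale1r eqxx orbT.
Qed.

(** Both xyz and xyt are nonzero scalars, so z and t are proportional. *)
Lemma coherent_apex_unique (x y z t : A) :
    edge rho B x y -> edge rho B y z -> edge rho B z x ->
    edge rho B y t -> edge rho B t x ->
  z = t.
Proof.
case: cohB => -[_ unitB _ _] freeB spanB.
move=> /and3P[xB yB /eqP xy] /and3P[_ zB /eqP yz] /and3P[_ _ /eqP zx].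
move=> /and3P[_ tB /eqP yt] /and3P[_ _ /eqP tx].
have apex v : v \in B -> y * v = rho *: (v * y) -> v * x = rho *: (x * v) ->
    exists2 a : F, x * y * v = a%:A & a != 0.
  move=> vB yv vx; have /vlineP[a def_a] : x * y * v \in 1%VS.
    by apply: (triangle_scalar rho_prim spanB) => //; apply: memv_span.
  by exists a => //; apply: unit_scalar_neq0 def_a; rewrite !unitrMl ?unitB.
have [a xyz _] := apex z zB yz zx; have [b xyt b_neq0] := apex t tB yt tx.
apply: (@free_mem_scale _ _ B _ _ (b^-1 * a) freeB zB tB).
apply: (mulrI (_ : x * y \is a GRing.unit)); first by rewrite unitrMl ?unitB.
by rewrite -scalerAr xyt xyz !scalerA mulrAC mulVf ?mul1r.
Qed.

End Coherent.

Theorem proposition3p4 (F : fieldType) (rho : F) (A : falgType F) (B : seq A)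
    (hrho : 3.-primitive_root rho) (hA : central_simple A)
    (hB : coherent_three_central_set rho B) :
  ~ exists c : seq A, is_cycle rho B c /\ (3 < size c)%N.
Proof.
case=> c [[cB cyc]]; apply/negP; rewrite -leqNgt.
apply: no_long_cycle cyc => [x y xc yc|x y z t].
  by apply: (coherent_tournament hrho hB); apply: cB.
exact: (coherent_apex_unique hrho hB).
Qed.
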